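(* Let $(a_n)_{n\ge1}$ be the Kentucky-2 sequence. Then $a_1=1$, $a_2=2$, $a_3=3$, $a_4=4$ and $a_{n+1}=a_{n-1}+2a_{n-3}$ for all $n\ge 4$. Consequently, for all $n\ge1$, \[ a_{2n}=2^n \qquad\text{and}\qquad a_{2n-1}=\tfrac13\left(2^{n+1}+(-1)^n\right). \]
   Context: The Kentucky-2 sequence $(a_n)_{n\ge1}$ is defined as follows. The index $\ell$ (and the term $a_\ell$) belongs to bin number $\lceil \ell/2\rceil$, so the $k$-th bin is $b_k=\{a_{2k-1},a_{2k}\}$. A legal decomposition of an integer $m\ge0$ using terms from $\{a_1,\dots,a_N\}$ is an expression $m=a_{\ell_1}+\cdots+a_{\ell_k}$ with $k\ge0$ and $1\le\ell_1<\cdots<\ell_k\le N$ such that no two summands lie in the same bin or in two consecutive bins, i.e. $\lceil \ell_{j+1}/2\rceil-\lceil \ell_j/2\rceil\ge2$ for all $j$. The sequence is built greedily: $a_1=1$, and for $N\ge1$, $a_{N+1}$ is the smallest positive integer having no legal decomposition using terms from $\{a_1,\dots,a_N\}$. (Its first terms are $1,2,3,4,5,8,11,16,21,32,\dots$.) *)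

(* Defs.v *)
From mathcomp Require Import all_boot all_order all_algebra.

Set Implicit Arguments.
Unset Strict Implicit.
Unset Printing Implicit Defensive.

(* [uphalf l] is the ceiling of l / 2. *)
Definition bin (l : nat) : nat := uphalf l.

(* [s] is the list of indices l_1 < ... < l_k; it may be empty. *)
Definition legal (N : nat) (s : seq nat) : bool :=
  [&& all (fun l => 1 <= l <= N) s,
      sorted ltn s
    & sorted (fun i j => bin i + 2 <= bin j) s].

Definition has_legal_decomposition (a : nat -> nat) (N m : nat) : Prop :=
  exists2 s : seq nat, legal N s & m = \sum_(l <- s) a l.

(* The sequence is indexed from 1; the value [a 0] is unconstrained. *)
Definition is_kentucky2 (a : nat -> nat) : Prop :=
  a 1 = 1 /\
  forall N : nat, 1 <= N ->
    [/\ 0 < a N.+1,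
        ~ has_legal_decomposition a N (a N.+1)
      & forall m : nat, 0 < m -> ~ has_legal_decomposition a N m ->
          a N.+1 <= m].

(* [is_kentucky2] is satisfiable: the greedy construction never gets stuck,
   since only finitely many integers are decomposable at each step. *)
Section Existence.

Let legal_sums (a : nat -> nat) (N : nat) : seq nat :=
  [seq \sum_(l <- s) a l |
    s <- [seq s <- [seq mask (tval t) (iota 1 N) | t <- enum {: N.-tuple bool}]
            | legal N s]].

Local Lemma legal_sumsP a N m :
  reflect (has_legal_decomposition a N m) (m \in legal_sums a N).
Proof.
apply: (iffP mapP) => [[s]|[s sL ->]].
  by rewrite mem_filter => /andP[sL _] ->; exists s.
exists s => //; rewrite mem_filter sL /=.
have /and3P[/allP sN s_lt _] := sL.
pose f := [seq (i \in s) | i <- iota 1 N].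
have sz : size f == N by rewrite size_map size_iota.
apply/mapP; exists (Tuple sz); first by rewrite mem_enum.
rewrite /= /f -filter_mask.
apply: (irr_sorted_eq ltn_trans ltnn) => //.
  by apply: sorted_filter; [exact: ltn_trans | exact: iota_ltn_sorted].
move=> i; rewrite mem_filter mem_iota add1n ltnS.
by case: (boolP (i \in s)) => //= /sN ->.
Qed.

Local Lemma next_ex a N : exists m, (0 < m) && (m \notin legal_sums a N).
Proof.
have le_sumn (t : seq nat) k : k \in t -> k <= sumn t.
  elim: t => //= x t IH; rewrite inE => /orP[/eqP ->|/IH kt].
    exact: leq_addr.
  exact: leq_trans kt (leq_addl _ _).
exists (sumn (legal_sums a N)).+1; rewrite /=.
by apply/negP => /le_sumn; rewrite ltnn.
Qed.

Let next a N := ex_minn (next_ex a N).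

Local Fixpoint pre (N : nat) : nat -> nat :=
  if N is N'.+1 then
    fun i => if i == N'.+1 then next (pre N') N' else pre N' i
  else fun=> 0.

Local Lemma preE N i : i <= N -> pre N i = pre i i.
Proof.
elim: N => [|N IH]; first by rewrite leqn0 => /eqP ->.
rewrite leq_eqVlt ltnS => /orP[/eqP -> //|iN] /=.
by rewrite ltn_eqF ?ltnS // IH.
Qed.

Local Lemma decomp_ext a b N m : (forall i, i <= N -> a i = b i) ->
  has_legal_decomposition a N m -> has_legal_decomposition b N m.
Proof.
move=> ab [s sL ->]; exists s => //.
have /and3P[/allP sN _ _] := sL.
by apply: eq_big_seq => i /sN /andP[_ /ab].
Qed.

Lemma is_kentucky2_ex : exists a, is_kentucky2 a.
Proof.
exists (fun i => pre i i).
have ext N i : i <= N -> pre i i = pre N i by move/preE.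
have step N : [/\ 0 < pre N.+1 N.+1,
    ~ has_legal_decomposition (fun i => pre i i) N (pre N.+1 N.+1)
  & forall m, 0 < m -> ~ has_legal_decomposition (fun i => pre i i) N m ->
      pre N.+1 N.+1 <= m].
  rewrite /= eqxx /next; case: ex_minnP => x /andP[x0 xN] xmin.
  split=> //.
    by move/(decomp_ext (@ext N))/legal_sumsP; apply/negP.
  move=> m m0 mN; apply: xmin; rewrite m0 /=.
  apply/negP => /legal_sumsP mS; apply: mN.
  by apply: decomp_ext mS => i /ext.
split=> // .
have [p0 _ pmin] := step 0.
apply/eqP; rewrite eqn_leq p0 andbT; apply: pmin => // -[[|l s]].
  by rewrite big_nil.
by case/and3P => /andP[]; case: l.
Qed.

End Existence.

(* Main.v *)
Require Import Defs.
From mathcomp Require Import all_boot all_order all_algebra.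
From mathcomp Require Import zify ring.

(** The integers with a legal decomposition using [a_1, ..., a_N] are exactly
those below [a_(N+1)].  Indeed, a decomposition using [a_(N+1)] is [a_(N+1)]
plus a decomposition using [a_1, ..., a_q], where [q = 2 (N./2 - 1)] is the last
index lying at least two bins below [N + 1]; inductively these two kinds of
integers fill [[0, a_(N+1))] and [[a_(N+1), a_(N+1) + a_(q+1))], so that
[a_(N+2) = a_(N+1) + a_(q+1)].  The recurrence and the closed forms follow by
separating the parities of the index. *)

Definition last_compatible (N : nat) : nat := (N./2 - 1).*2.

Lemma last_compatible_le N : last_compatible N <= N.
Proof. rewrite /last_compatible; lia. Qed.

(** For [N <= 1] the index [N.+1] lies in the first bin, so no gap is possible, yet the truncated
    subtraction gives [last_compatible N = 0]; the guard [1 < N] rules out [l = 0] there. *)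
Lemma bin_gap_le_last_compatible N l :
  (bin l + 2 <= bin N.+1) = (1 < N) && (l <= last_compatible N).
Proof. rewrite /bin /last_compatible; lia. Qed.

(** Both relations are transitive; in pairwise form an appended index is compared with every earlier
    one. *)
Lemma legalE N s :
  legal N s = [&& all (fun l => 1 <= l <= N) s, pairwise ltn s
                & pairwise (fun i j => bin i + 2 <= bin j) s].
Proof.
rewrite /legal !sorted_pairwise //; last exact: ltn_trans.
by move=> j i k; rewrite /bin; lia.
Qed.

Lemma legal_rcons_last N s :
  legal N.+1 (rcons s N.+1) = legal (last_compatible N) s.
Proof.
rewrite !legalE !pairwise_rcons all_rcons ltnS leqnn /=.
case: (pairwise ltn s); rewrite ?andbF //=.
case: (pairwise _ s); rewrite ?andbF //= !andbT -!all_predI.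
apply: eq_all => l /=.
rewrite bin_gap_le_last_compatible.
have := last_compatible_le N; rewrite /last_compatible; lia.
Qed.

Lemma legal_widen N s : legal N s -> legal N.+1 s.
Proof.
case/and3P=> sN s1 s2; apply/and3P; split=> //.
by apply: sub_all sN => l /andP[-> /leqW].
Qed.

Lemma legal_rcons_narrow N s l :
  l != N.+1 -> legal N.+1 (rcons s l) -> legal N (rcons s l).
Proof.
move=> lN; rewrite !legalE => /and3P[sN s1 s2]; apply/and3P; split=> //.
move: sN s1; rewrite pairwise_rcons !all_rcons => /andP[lb sN] /andP[sl _].
have {}lb : 1 <= l <= N by lia.
rewrite lb /=; apply/allP => i si.
have := allP sN _ si; have := allP sl _ si => /=; lia.
Qed.

Lemma has_legal_decompositionS a N m :
  has_legal_decomposition a N.+1 m <->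
  has_legal_decomposition a N m \/
  exists2 r, has_legal_decomposition a (last_compatible N) r & m = a N.+1 + r.
Proof.
split=> [[s]|[[s /legal_widen sL ->]|[r [s sL ->] ->]]]; last 2 first.
- by exists s.
- exists (rcons s N.+1); first by rewrite legal_rcons_last.
  by rewrite big_rcons addnC.
(* Indices increase, so [N.+1] can only occur as the last one. *)
case/lastP: s => [|s l] sL ->; first by left; exists [::].
have [lN|lN] := eqVneq l N.+1; last first.
  by left; exists (rcons s l) => //; apply: legal_rcons_narrow.
right; exists (\sum_(i <- s) a i); last by rewrite big_rcons lN addnC.
by exists s => //; rewrite -legal_rcons_last -lN; rewrite lN in sL *.
Qed.

Lemma has_legal_decomposition0 a m : has_legal_decomposition a 0 m <-> m = 0.
Proof.
split=> [[[|l s]]|->]; first by rewrite big_nil.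
  by case/and3P => /andP[]; case: l.
by exists [::]; rewrite ?big_nil.
Qed.

Lemma initial_segment_decomposableS a N x :
  (forall m, has_legal_decomposition a N m <-> m < a N.+1) ->
  (forall m, has_legal_decomposition a (last_compatible N) m <-> m < x) ->
  forall m, has_legal_decomposition a N.+1 m <-> m < a N.+1 + x.
Proof.
move=> HN Hx m; rewrite has_legal_decompositionS HN.
split=> [[|[r /Hx rx ->]]|mx]; first lia.
  by rewrite ltn_add2l.
have [mN|Nm] := ltnP m (a N.+1); first by left.
right; exists (m - a N.+1); last by rewrite subnKC.
by apply/Hx; lia.
Qed.

Lemma kentucky2_first_gap a N b : is_kentucky2 a -> 1 <= N ->
  (forall m, has_legal_decomposition a N m <-> m < b) -> a N.+1 = b.
Proof.
move=> [_ ha] /ha[aN0 aNn aNmin] Hb.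
(* The empty sum decomposes 0, so [b] is positive and competes in the greedy minimum. *)
have b0 : 0 < b by apply/Hb; exists [::]; rewrite ?big_nil.
apply/eqP; rewrite eqn_leq aNmin //=; last by rewrite Hb ltnn.
by rewrite leqNgt; apply/negP => /Hb.
Qed.

Lemma kentucky2_decomposableP a N m : is_kentucky2 a ->
  has_legal_decomposition a N m <-> m < a N.+1.
Proof.
move=> ha; elim/ltn_ind: N m => -[_ m|N IH].
  by rewrite has_legal_decomposition0 ha.1; split; lia.
(* Strong induction supplies both [N] and [last_compatible N]; the greedy rule then identifies the
   resulting bound with [a N.+2]. *)
have HS := initial_segment_decomposableS _ _ _ (IH _ (ltnSn N))
  (IH _ (last_compatible_le N)).
by move=> m; rewrite (kentucky2_first_gap _ N.+1 _ ha _ HS).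
Qed.

Lemma kentucky2_step a N : is_kentucky2 a ->
  a N.+2 = a N.+1 + a (last_compatible N).+1.
Proof.
move=> ha; apply: kentucky2_first_gap => // m.
by apply: initial_segment_decomposableS => r; apply: kentucky2_decomposableP.
Qed.

Lemma kentucky2_initial a : is_kentucky2 a ->
  [/\ a 1 = 1, a 2 = 2, a 3 = 3 & a 4 = 4].
Proof.
move=> ha; have a1 := ha.1.
have a2 : a 2 = 2 by rewrite kentucky2_step //= a1.
have a3 : a 3 = 3 by rewrite kentucky2_step //= a2 a1.
by have a4 : a 4 = 4 by rewrite kentucky2_step //= a3 a1.
Qed.

Lemma kentucky2_step_even a k : is_kentucky2 a ->
  a k.*2.+4 = a k.*2.+3 + a k.*2.+1.
Proof.
move=> ha; rewrite kentucky2_step //.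
by congr (_ + a _); rewrite /last_compatible; lia.
Qed.

(** Indices [k.*2.+3] and [k.*2.+4] share a bin, hence the same added term [a k.*2.+1] as in the
    even step. *)
Lemma kentucky2_step_odd a k : is_kentucky2 a ->
  a k.*2.+4.+1 = a k.*2.+4 + a k.*2.+1.
Proof.
move=> ha; rewrite kentucky2_step //.
by congr (_ + a _); rewrite /last_compatible; lia.
Qed.

(** The second equality carries the induction: by the even step its left side is [a k.*2.+4], and
    adding the two steps doubles it. *)
Lemma kentucky2_pow2 a k : is_kentucky2 a ->
  a k.*2.+2 = 2 ^ k.+1 /\ a k.*2.+3 + a k.*2.+1 = 2 ^ k.+2.
Proof.
move=> ha; have [a1 a2 a3 _] := kentucky2_initial _ ha.
elim: k => [|k [IHe IHo]]; first by rewrite a1 a2 a3.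
have e4 := kentucky2_step_even _ k ha; have e5 := kentucky2_step_odd _ k ha.
rewrite doubleS e4 IHo; split=> //.
by rewrite e5 e4 (expnS 2 k.+2) -IHo; lia.
Qed.

Lemma kentucky2_odd_closed_form a k : is_kentucky2 a ->
  ((a k.*2.+1)%:R = 1 / 3 * (2 ^+ k.+2 + (-1) ^+ k.+1) :> rat)%R.
Proof.
move=> ha; elim: k => [|k IH]; first by rewrite ha.1; apply/eqP.
have [_ /(congr1 (fun n => n%:R : rat)%R)] := kentucky2_pow2 _ k ha.
(* This is the first-order recurrence [a k.*2.+3 = 2 ^ k.+2 - a k.*2.+1], read in [rat]. *)
rewrite GRing.natrD GRing.natrX doubleS => /(canRL (GRing.addrK _)) ->.
by rewrite IH !GRing.exprS; field.
Qed.

Theorem theorem1p1 (a : nat -> nat) (ha : is_kentucky2 a) :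
  [/\ a 1 = 1, a 2 = 2, a 3 = 3 & a 4 = 4] /\
  (forall n : nat, 4 <= n -> a n.+1 = a (n - 1) + 2 * a (n - 3)) /\
  (forall n : nat, 1 <= n ->
    a (2 * n) = 2 ^ n /\
    ((a (2 * n - 1)%N)%:R = 1 / 3 * (2 ^+ n.+1 + (-1) ^+ n) :> rat)%R).
Proof.
split; first exact: kentucky2_initial.
split=> [n n4|[//|k] _]; last first.
  have -> : 2 * k.+1 = k.*2.+2 by lia.
  rewrite subn1 /=; split; first exact: (kentucky2_pow2 _ k ha).1.
  exact: kentucky2_odd_closed_form.
(* For odd [n] all three indices are even and the claim is an identity of powers of 2; for even [n]
   the odd and even steps compose. *)
pose k := n./2 - 2; have [n_odd|n_even] := boolP (odd n).
  have -> : n = k.*2.+4.+1 by rewrite /k; lia.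
  have -> : k.*2.+4.+1 - 1 = k.+1.*2.+2 by lia.
  have -> : k.*2.+4.+1 - 3 = k.*2.+2 by lia.
  have -> : k.*2.+4.+2 = k.+2.*2.+2 by lia.
  rewrite (kentucky2_pow2 _ k ha).1 (kentucky2_pow2 _ k.+1 ha).1.
  by rewrite (kentucky2_pow2 _ k.+2 ha).1 !expnS; lia.
have -> : n = k.*2.+4 by rewrite /k; lia.
have -> : k.*2.+4 - 1 = k.*2.+3 by lia.
have -> : k.*2.+4 - 3 = k.*2.+1 by lia.
rewrite kentucky2_step_odd // kentucky2_step_even //; lia.
Qed.
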